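(* For $\ell=0,1,\ldots,N$ let $$\hat{\mathcal{K}}_\ell(p,q)=\prod_{m=1}^N\prod_{n=1}^{N-\ell}\frac{\Gamma\big(i(p_m-q_n)/\hbar\mu-g/2\hbar\big)}{\Gamma\big(i(p_m-q_n)/\hbar\mu+g/2\hbar\big)},\qquad p\in\mathbb{C}^N,\ q\in\mathbb{C}^{N-\ell}.$$ Then for every $k\in\{1,\ldots,N\}$ and $\tau\in\{+,-\}$, as identities of meromorphic functions, $$\hat A_{\tau k,\rm nr}(p_1,\ldots,p_N)\hat{\mathcal{K}}_\ell(p,q)=\sum_{j=0}^{\min(k,\ell)}\binom{\ell}{j}\hat A_{-\tau(k-j),\rm nr}(q_1,\ldots,q_{N-\ell})\hat{\mathcal{K}}_\ell(p,q),$$ where $\hat A_{\pm m,\rm nr}(q_1,\ldots,q_{N-\ell})\equiv0$ for $m>N-\ell$ and $\hat A_{0,\rm nr}\equiv1$.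
   Context: Fix $\hbar,\mu,g>0$; $\Gamma$ is Euler's gamma function. The operator $\exp(\mp i\hbar\mu\partial_{p_m})$ acts on meromorphic $f$ by $f(p)\mapsto f(p_1,\ldots,p_m\mp i\hbar\mu,\ldots)$. For $n$ variables and $k=1,\ldots,n$, $$\hat A_{\pm k,\rm nr}(p)=\sum_{I\subset\{1,\ldots,n\},|I|=k}\ \prod_{m\in I,m'\notin I}\frac{p_m-p_{m'}\mp i\mu g}{p_m-p_{m'}}\prod_{m\in I}\exp(\mp i\hbar\mu\partial_{p_m}).$$ *)

(* Defs.v *)
From HB Require Import structures.
From mathcomp Require Import all_boot all_order all_algebra.
From mathcomp Require Import all_classical all_reals all_analysis.
From mathcomp Require Import complex.
Set Implicit Arguments. Unset Strict Implicit. Unset Printing Implicit Defensive.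
Import Order.TTheory GRing.Theory Num.Theory.
Import numFieldTopology.Exports numFieldNormedType.Exports.
Local Open Scope ring_scope.
Local Open Scope complex_scope.

Section Defs.
Variable R : realType.
Local Notation C := R[i].

Definition natcpow (n : nat) (z : C) : C :=
  ((expR (complex.Re z * ln n%:R))%:C) *
  ((cos (complex.Im z * ln n%:R)) +i* (sin (complex.Im z * ln n%:R))).

(* Euler's Gamma function on C, via Gauss' product formula
   Gamma z = lim_{n -> oo} n! n^z / (z (z+1) ... (z+n)),
   valid for z not in {0,-1,-2,...} (value at the poles is irrelevant). *)
Definition Gamma (z : C) : C :=
  limn ((fun n : nat => (n`!)%:R * natcpow n z / \prod_(j < n.+1) (z + j%:R))
          : nat -> C^o).

Definition sgnC (tau : bool) : C := if tau then 1 else -1.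

(* The operator \hat A_{tau k, nr} in n variables acting on f : C^n -> C,
   evaluated at p:
   sum over I subset {1..n}, |I| = k, of
     prod_{m in I, m' notin I} (p_m - p_m' - tau i mu g)/(p_m - p_m')
     * f(p shifted by - tau i hbar mu in the coordinates of I).
   For k = 0 this is the identity, for k > n it is 0 (no such I). *)
Definition Anr (hbar mu g : R) (n : nat) (tau : bool) (k : nat)
    (f : ('I_n -> C) -> C) (p : 'I_n -> C) : C :=
  \sum_(I : {set 'I_n} | #|I| == k)
     (\prod_(m in I) \prod_(m' in ~: I)
        ((p m - p m' - sgnC tau * 'i * (mu * g)%:C) / (p m - p m')))
     * f (fun m => if m \in I then p m - sgnC tau * 'i * (hbar * mu)%:C else p m).

Definition Khat (hbar mu g : R) (N M : nat) (p : 'I_N -> C) (q : 'I_M -> C) : C :=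
  \prod_(m < N) \prod_(n < M)
    (Gamma ('i * (p m - q n) / (hbar * mu)%:C - (g / (2 * hbar))%:C)
     / Gamma ('i * (p m - q n) / (hbar * mu)%:C + (g / (2 * hbar))%:C)).

(* genericity: (p,q) off the (locally finite) union of hyperplanes containing
   all singularities of both sides *)
Definition generic_pq (hbar mu g : R) (N M : nat) (p : 'I_N -> C) (q : 'I_M -> C) : Prop :=
  (forall m m' : 'I_N, m != m' -> p m != p m') /\
  (forall n n' : 'I_M, n != n' -> q n != q n') /\
  (forall (m : 'I_N) (n : 'I_M) (z : int),
     'i * (p m - q n) / (hbar * mu)%:C - (g / (2 * hbar))%:C != z%:~R /\
     'i * (p m - q n) / (hbar * mu)%:C + (g / (2 * hbar))%:C != z%:~R).

End Defs.

(* Main.v *)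
(* The Gauss product gives [Gamma (z + 1) = z * Gamma z], so each shift operator
   multiplies the kernel by a rational function and the theorem becomes a rational
   identity.  With [u] and [v] the suitably translated [p] and [q], and [c] the
   coupling, it compares a sum over subsets of the [u i] with one over subsets of
   the [v j].

   When there are as many [v j] as [u i], expand
     [det (1 / (u i - v j + c) + t / (u i - v j))]
   in powers of [t], once by choosing rows and once by choosing columns: every term
   is a Cauchy determinant at shifted points, and its ratio to the Cauchy
   determinant at [t = 0] is the corresponding summand.  The general case follows by
   sending [l] of the [v j] to infinity: their factors become 1, so a subset counts
   only through its finite part, and the subsets with a given finite part are counted
   by a binomial coefficient. *)

Require Import Defs.
From HB Require Import structures.
From mathcomp Require Import all_boot all_order all_fingroup all_algebra.
From mathcomp Require Import all_classical all_reals all_analysis.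
From mathcomp Require Import fintype finset complex ring.
Import Order.TTheory GRing.Theory Num.Theory.
Import numFieldTopology.Exports numFieldNormedType.Exports.
Local Open Scope ring_scope.

(** * Determinants mixing two matrices, and products over pairs of indices *)

(** Both sides are the coefficient of [t^k] in [det (A + t B)]. In the Leibniz expansion, the term
    of a permutation [s] matches the row set [s^-1(J)] with the column set [J]. *)
Lemma sum_det_mix (R : comNzRingType) (n k : nat) (A B : 'M[R]_n) :
  \sum_(I : {set 'I_n} | #|I| == k)
     \det (\matrix_(i, j) (if i \in I then B i j else A i j)) =
  \sum_(J : {set 'I_n} | #|J| == k)
     \det (\matrix_(i, j) (if j \in J then B i j else A i j)).
Proof.
rewrite /determinant exchange_big [RHS]exchange_big /=; apply: eq_bigr => s _.
rewrite (reindex (fun J : {set 'I_n} => s @^-1: J)) /=; last first.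
  by apply: onW_bij; exists (fun J : {set 'I_n} => s^-1%g @^-1: J) => J;
     apply/setP=> i; rewrite !inE ?permK ?permKV.
apply: eq_big => [J|J _]; first by rewrite card_preimset //; apply: perm_inj.
by congr (_ * _); apply: eq_bigr => i _; rewrite !mxE inE.
Qed.

(** Brings a product over ordered pairs to the shape of a Vandermonde product, where each unordered
    pair occurs once. *)
Lemma prod_offdiag_pairs (R : comNzRingType) (n : nat) (G : 'I_n -> 'I_n -> R) :
  (forall i, G i i = 1) ->
  \prod_i \prod_j G i j = \prod_(i < n) \prod_(j < n | (i < j)%N) (G i j * G j i).
Proof.
move=> G1.
have split_row i : \prod_j G i j =
    (\prod_(j < n | (i < j)%N) G i j) * \prod_(j < n | (j < i)%N) G i j.
  rewrite (bigID (fun j : 'I_n => (i < j)%N)) /=; congr (_ * _).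
  rewrite (bigD1 i) ?ltnn //= G1 mul1r; apply: eq_bigl => j.
  by rewrite -leqNgt andbC -(inj_eq val_inj) -ltn_neqAle.
under eq_bigr do rewrite split_row.
under [RHS]eq_bigr do rewrite big_split.
rewrite !big_split /=; congr (_ * _).
by rewrite (exchange_big_dep xpredT).
Qed.

(** * Cauchy determinants at shifted points, and the identity with equally many variables *)

Section Shift.
Variable F : fieldType.

Definition shift_on n (d : F) (I : {set 'I_n}) (u : 'I_n -> F) : 'I_n -> F :=
  fun i => if i \in I then u i + d else u i.

Definition diffprod n (u : 'I_n -> F) : F :=
  \prod_(i < n) \prod_(j < n | (i < j)%N) (u j - u i).

Lemma diffprod_neq0 {n} {u : 'I_n -> F} : injective u -> diffprod n u != 0.
Proof.
move=> u_inj; apply/prodf_neq0 => i _; apply/prodf_neq0 => j ij.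
by rewrite subr_eq0; apply: contraTneq ij => /u_inj ->; rewrite ltnn.
Qed.

(** A difference changes only when exactly one of its indices lies in [I]; with that index first, it
    is multiplied by [(u i - u j + d) / (u i - u j)]. *)
Lemma diffprod_shift n d (I : {set 'I_n}) (u : 'I_n -> F) : injective u ->
  diffprod n (shift_on n d I u) =
  diffprod n u * \prod_(i in I) \prod_(j in ~: I) ((u i - u j + d) / (u i - u j)).
Proof.
move=> u_inj.
pose G i j := if (i \in I) && (j \notin I) then (u i - u j + d) / (u i - u j) else 1.
have -> : \prod_(i in I) \prod_(j in ~: I) ((u i - u j + d) / (u i - u j)) =
          \prod_i \prod_j G i j.
  rewrite big_mkcond /=; apply: eq_bigr => i _; rewrite /G.
  case: (i \in I) => /=; last by rewrite big1.
  by rewrite big_mkcond /=; apply: eq_bigr => j _; rewrite inE.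
rewrite prod_offdiag_pairs => [|i]; last by rewrite /G andbN.
rewrite /diffprod -big_split; apply: eq_bigr => i _ /=.
rewrite -big_split; apply: eq_bigr => j ij /=.
have uij : u i - u j != 0.
  by rewrite subr_eq0; apply: contraTneq ij => /u_inj ->; rewrite ltnn.
have uji : u j - u i != 0 by rewrite -opprB oppr_eq0.
rewrite /G /shift_on; case: (i \in I); case: (j \in I) => /=; field => //.
Qed.

Definition cauchymx n (u v : 'I_n -> F) : 'M[F]_n := \matrix_(i, j) (u i - v j)^-1.

(* Clearing denominators, row [i] of the Cauchy matrix consists of the values at
   [u i] of [n] polynomials of degree [< n] depending only on [v]; hence it
   factors through the Vandermonde matrix of [u].  At [u = v] the cleared matrix
   is diagonal, which shows that the other factor does not vanish. *)
Lemma det_cauchymx n (v : 'I_n -> F) : exists K : F,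
  (injective v -> K != 0) /\
  forall u : 'I_n -> F, (forall i j, u i != v j) ->
    \det (cauchymx n u v) * \prod_i \prod_j (u i - v j) = diffprod n u * K.
Proof.
pose P j : {poly F} := \prod_(j' < n | j' != j) ('X - (v j')%:P).
have hornerP j x : (P j).[x] = \prod_(j' < n | j' != j) (x - v j').
  by rewrite horner_prod; apply: eq_bigr => j' _; rewrite hornerXsubC.
have sizeP j : (size (P j) <= n)%N.
  rewrite /P -big_filter size_prod_XsubC size_filter -sum1_count.
  by rewrite (sum1_card (predC1 j)) cardC1 card_ord prednK // (leq_trans _ (ltn_ord j)).
pose Cf : 'M[F]_n := \matrix_(k, j) (P j)`_k.
have fact (u : 'I_n -> F) :
    \det (\matrix_(i, j) (P j).[u i] : 'M[F]_n) = diffprod n u * \det Cf.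
  have -> : diffprod n u = \det (Vandermonde n (\row_i u i))^T.
    rewrite det_tr det_Vandermonde; apply: eq_bigr => i _.
    by apply: eq_bigr => j _; rewrite !mxE.
  rewrite -det_mulmx; congr (\det _); apply/matrixP => i j.
  rewrite !mxE (horner_coef_wide _ (sizeP j)); apply: eq_bigr => k _.
  by rewrite !mxE mulrC.
exists (\det Cf); split=> [v_inj | u uv].
  have: \det (\matrix_(i, j) (P j).[v i] : 'M[F]_n) != 0.
    have -> : \matrix_(i, j) (P j).[v i] = diag_mx (\row_i (P i).[v i]).
      apply/matrixP => i j; rewrite !mxE; case: eqVneq => [->|ij] //=.
      by rewrite mulr0n hornerP (bigD1 i) //= subrr mul0r.
    rewrite det_diag; apply/prodf_neq0 => i _; rewrite mxE hornerP.
    apply/prodf_neq0 => j ji; rewrite subr_eq0.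
    by apply: contraNneq ji => /v_inj ->.
  by rewrite fact mulf_eq0 negb_or => /andP[].
have -> : \prod_i \prod_j (u i - v j) =
          \det (diag_mx (\row_i \prod_j (u i - v j))).
  by rewrite det_diag; apply: eq_bigr => i _; rewrite mxE.
rewrite -fact mulrC -det_mulmx; congr (\det _); apply/matrixP => i j.
rewrite mul_diag_mx !mxE hornerP (bigD1 j) //= mulrC mulrA mulVf ?mul1r //.
by rewrite subr_eq0.
Qed.

Lemma det_cauchymx_neq0 n (u v : 'I_n -> F) : injective u -> injective v ->
  (forall i j, u i != v j) -> \det (cauchymx n u v) != 0.
Proof.
move=> u_inj v_inj uv; have [K [/(_ v_inj) K0 /(_ u uv) detE]] := det_cauchymx n v.
have: diffprod n u * K != 0 by rewrite mulf_neq0 // diffprod_neq0.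
by apply: contraNneq => det0; rewrite -detE det0 mul0r.
Qed.

(** The constant [K] of [det_cauchymx] depends on [v] alone, so it is common to [u] and its shift.
    The two determinants differ only through the Vandermonde product and the cleared
    denominators. *)
Lemma det_cauchymx_shiftl n d (I : {set 'I_n}) (u v : 'I_n -> F) :
    injective u -> (forall i j, u i != v j) -> (forall i j, u i + d != v j) ->
  \det (cauchymx n (shift_on n d I u) v) =
  \det (cauchymx n u v) *
  (\prod_(i in I) \prod_(j in ~: I) ((u i - u j + d) / (u i - u j)) *
   \prod_(i in I) \prod_j ((u i - v j) / (u i - v j + d))).
Proof.
move=> u_inj uv udv; have [K [_ detE]] := det_cauchymx n v.
have sv i j : shift_on n d I u i != v j by rewrite /shift_on; case: ifP.
set PI := \prod_(i in I) \prod_j _.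
have PE : \prod_i \prod_j (u i - v j) =
          (\prod_i \prod_j (shift_on n d I u i - v j)) * PI.
  rewrite /PI [X in _ * X]big_mkcond -big_split; apply: eq_bigr => i _ /=.
  rewrite /shift_on; case: ifP => _; last by rewrite mulr1.
  rewrite -big_split; apply: eq_bigr => j _ /=; rewrite addrAC mulrC divfK //.
  by rewrite addrAC subr_eq0.
have nz : \prod_i \prod_j (shift_on n d I u i - v j) != 0.
  by apply/prodf_neq0 => i _; apply/prodf_neq0 => j _; rewrite subr_eq0.
apply: (mulIf nz); rewrite detE // diffprod_shift //.
rewrite mulrAC -(detE u uv) PE; ring.
Qed.

Lemma det_cauchymxC n (u v : 'I_n -> F) :
  \det (cauchymx n u v) = (-1) ^+ n * \det (cauchymx n v u).
Proof.
rewrite -detZ -det_tr; congr (\det _); apply/matrixP => i j.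
by rewrite !mxE mulN1r -invrN opprB.
Qed.

Lemma det_cauchymx_shiftr n d (J : {set 'I_n}) (u v : 'I_n -> F) :
    injective v -> (forall i j, u i != v j) -> (forall i j, u i != v j + d) ->
  \det (cauchymx n u (shift_on n d J v)) =
  \det (cauchymx n u v) *
  (\prod_(i in J) \prod_(j in ~: J) ((v i - v j + d) / (v i - v j)) *
   \prod_(i in J) \prod_j ((v i - u j) / (v i - u j + d))).
Proof.
move=> v_inj uv uvd; rewrite det_cauchymxC det_cauchymx_shiftl //.
- by rewrite [\det (cauchymx n u v)]det_cauchymxC !mulrA.
- by move=> i j; rewrite eq_sym.
- by move=> i j; rewrite eq_sym.
Qed.

Lemma source_identity_square n k c (u v : 'I_n -> F) :
    injective u -> injective v ->
    (forall i j, u i != v j) -> (forall i j, u i - v j + c != 0) ->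
  \sum_(I : {set 'I_n} | #|I| == k)
    (\prod_(i in I) \prod_(j in ~: I) ((u i - u j - c) / (u i - u j)) *
     \prod_(i in I) \prod_j ((u i - v j + c) / (u i - v j))) =
  \sum_(J : {set 'I_n} | #|J| == k)
    (\prod_(i in J) \prod_(j in ~: J) ((v i - v j + c) / (v i - v j)) *
     \prod_(i in J) \prod_j ((u j - v i + c) / (u j - v i))).
Proof.
move=> u_inj v_inj uv uvc.
(* The Cauchy matrix of [u] and [w] has entries [1 / (u i - v j + c)]. Lowering [u i] by [c] or
   raising [w j] by [c] turns an entry into [1 / (u i - v j)], so both sums become sums of mixed
   determinants of the same two matrices. *)
pose w i := v i - c.
have w_inj : injective w by move=> i j /addIr /v_inj.
have uw i j : u i != w j by rewrite -subr_eq0 opprB addrA addrAC.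
have D0 := det_cauchymx_neq0 n u w u_inj w_inj uw.
apply: (mulfI D0); rewrite !big_distrr /=.
transitivity (\sum_(I : {set 'I_n} | #|I| == k)
    \det (cauchymx n (shift_on n (- c) I u) w)).
  apply: eq_bigr => I _; rewrite det_cauchymx_shiftl //; last first.
    by move=> i j; rewrite (inj_eq (addIr _)).
  congr (_ * (_ * _)); apply: eq_bigr => i _; apply: eq_bigr => j _.
  by rewrite /w; congr (_ / _); ring.
transitivity (\sum_(J : {set 'I_n} | #|J| == k)
    \det (cauchymx n u (shift_on n c J w))); last first.
  apply: eq_bigr => I _; rewrite det_cauchymx_shiftr //; last first.
    by move=> i j; rewrite /w subrK.
  congr (_ * (_ * _)); apply: eq_bigr => i _; apply: eq_bigr => j _.
    by rewrite /w; congr (_ / _); ring.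
  have -> : w i - u j = - (u j - v i + c) by rewrite /w; ring.
  have -> : - (u j - v i + c) + c = - (u j - v i) by ring.
  by rewrite invrN mulrNN.
transitivity (\sum_(I : {set 'I_n} | #|I| == k)
   \det (\matrix_(i, j) (if i \in I then cauchymx n u v i j else cauchymx n u w i j))).
  apply: eq_bigr => I _; congr (\det _); apply/matrixP => i j; rewrite !mxE.
  by rewrite /shift_on /w; case: ifP => // _; congr (_^-1); ring.
rewrite sum_det_mix; apply: eq_bigr => I _; congr (\det _); apply/matrixP => i j.
by rewrite !mxE /shift_on /w; case: ifP => // _; congr (_^-1); ring.
Qed.
End Shift.

(** * Limits at infinity of rational functions *)

Section AtInfinity.
Variable F : numFieldType.

(* An algebraic form of "[f w] tends to [a] as [w] tends to infinity", for [f]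
   rational: [P / Q] is [f] in the coordinate [1 / w]. *)
Definition tends_at_infty (f : F -> F) (a : F) : Prop :=
  exists P Q : {poly F}, [/\ Q.[0] != 0, P.[0] = a * Q.[0] &
    forall s, s != 0 -> Q.[s] != 0 -> f s^-1 = P.[s] / Q.[s]].

Lemma tends_ext (f g : F -> F) a : f =1 g -> tends_at_infty f a -> tends_at_infty g a.
Proof.
by move=> fg [P [Q [Q0 PQ fE]]]; exists P, Q; split=> // s s0 Qs; rewrite -fg fE.
Qed.

Lemma tends_cst a : tends_at_infty (fun=> a) a.
Proof.
exists a%:P, 1; rewrite !hornerE; split; rewrite ?oner_neq0 // => s _ _.
by rewrite !hornerE divr1.
Qed.

Lemma tendsD f g a b : tends_at_infty f a -> tends_at_infty g b ->
  tends_at_infty (fun w => f w + g w) (a + b).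
Proof.
move=> [P [Q [Q0 P0 fE]]] [P' [Q' [Q'0 P'0 gE]]].
exists (P * Q' + P' * Q), (Q * Q'); split=> [||s s0].
- by rewrite hornerM mulf_neq0.
- by rewrite ?hornerD !hornerM P0 P'0; ring.
rewrite ?hornerD !hornerM mulf_eq0 negb_or => /andP[Qs Q's].
by rewrite fE // gE //; field; rewrite Qs Q's.
Qed.

Lemma tendsM f g a b : tends_at_infty f a -> tends_at_infty g b ->
  tends_at_infty (fun w => f w * g w) (a * b).
Proof.
move=> [P [Q [Q0 P0 fE]]] [P' [Q' [Q'0 P'0 gE]]].
exists (P * P'), (Q * Q'); split=> [||s s0].
- by rewrite hornerM mulf_neq0.
- by rewrite ?hornerD !hornerM P0 P'0; ring.
rewrite ?hornerD !hornerM mulf_eq0 negb_or => /andP[Qs Q's].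
by rewrite fE // gE //; field; rewrite ?Qs ?Q's.
Qed.

Lemma tends_sum (I : finType) (p : pred I) (f : I -> F -> F) (a : I -> F) :
  (forall i, p i -> tends_at_infty (f i) (a i)) ->
  tends_at_infty (fun w => \sum_(i | p i) f i w) (\sum_(i | p i) a i).
Proof.
move=> fa; elim: (index_enum I) => [|i s IHs].
  by rewrite big_nil; apply: tends_ext (tends_cst 0) => w; rewrite big_nil.
rewrite big_cons; case: ifP => pi.
  by apply: tends_ext (tendsD _ _ _ _ (fa i pi) IHs) => w; rewrite big_cons pi.
by apply: tends_ext IHs => w; rewrite big_cons pi.
Qed.

Lemma tends_prod (I : finType) (p : pred I) (f : I -> F -> F) (a : I -> F) :
  (forall i, p i -> tends_at_infty (f i) (a i)) ->
  tends_at_infty (fun w => \prod_(i | p i) f i w) (\prod_(i | p i) a i).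
Proof.
move=> fa; elim: (index_enum I) => [|i s IHs].
  by rewrite big_nil; apply: tends_ext (tends_cst 1) => w; rewrite big_nil.
rewrite big_cons; case: ifP => pi.
  by apply: tends_ext (tendsM _ _ _ _ (fa i pi) IHs) => w; rewrite big_cons pi.
by apply: tends_ext IHs => w; rewrite big_cons pi.
Qed.

Lemma tends_moebius x a b : x != 0 ->
  tends_at_infty (fun w => (x * w + a) / (x * w + b)) 1.
Proof.
(* With [s = 1 / w], numerator and denominator are both multiplied by [s]. *)
move=> x0; exists (x%:P + a *: 'X), (x%:P + b *: 'X).
rewrite !hornerE ?mulr0 ?addr0 ?mul1r; split=> // s s0; rewrite !hornerE => Qs.
have Qs' : x * s^-1 + b != 0.
  by rewrite -(inj_eq (mulIf s0)) mul0r mulrDl divfK.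
by field; rewrite Qs s0.
Qed.

Lemma poly_nonroot (P : {poly F}) : P != 0 -> exists x, ~~ root P x.
Proof.
move=> P0; pose rs := [seq i%:R : F | i <- iota 0 (size P)].
have : ~~ all (root P) rs.
  apply/negP => all_rs; have := max_poly_roots P0 all_rs.
  rewrite map_inj_uniq ?iota_uniq => [/(_ isT)|]; last first.
    by move=> i j /eqP; rewrite eqr_nat => /eqP.
  by rewrite size_map size_iota ltnn.
by case/allPn => x _ Px; exists x.
Qed.

(** If [a] were nonzero, [P] would be a nonzero polynomial, and some [s] that is neither zero nor
    the inverse of a bad point would be a root of neither [P] nor [Q], so [f s^-1] would not
    vanish. *)
Lemma tends_unique0 f a (bad : seq F) :
  tends_at_infty f a -> (forall w, w \notin bad -> f w = 0) -> a = 0.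
Proof.
move=> [P [Q [Q0 P0 fE]]] f0; apply/eqP; apply: contraT => a0.
have Pn0 : P != 0.
  by apply: contraNneq a0 => PE; move: P0; rewrite PE horner0 => /esym/eqP;
     rewrite mulf_eq0 (negPf Q0) orbF.
have Qn0 : Q != 0 by apply: contraNneq Q0 => ->; rewrite horner0.
pose B := \prod_(x <- 0 :: map GRing.inv bad) ('X - x%:P) : {poly F}.
have Bn0 : B != 0 by rewrite monic_neq0 // monic_prod_XsubC.
have [|s] := poly_nonroot (P * Q * B); first by rewrite !mulf_neq0.
rewrite !rootM !negb_or root_prod_XsubC inE negb_or -andbA => /and4P[Ps Qs s0 sbad].
have := fE s s0 Qs; rewrite f0.
  by move/esym/eqP; rewrite mulf_eq0 invr_eq0 -!rootE (negPf Ps) (negPf Qs).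
by apply: contra sbad => sb; rewrite -[s]invrK map_f.
Qed.

Lemma tends_unique f g a b (bad : seq F) :
  tends_at_infty f a -> tends_at_infty g b ->
  (forall w, w \notin bad -> f w = g w) -> a = b.
Proof.
move=> fa gb fg; apply/eqP; rewrite -subr_eq0; apply/eqP.
have ga : tends_at_infty (fun w => f w + (-1) * g w) (a + (-1) * b).
  by apply: tendsD => //; apply: tendsM => //; apply: tends_cst.
rewrite -mulN1r; apply: (tends_unique0 _ _ bad ga) => w wb.
by rewrite fg // mulN1r subrr.
Qed.
End AtInfinity.

(** * The identity with some variables at infinity *)

Section Degenerate.
Variable F : numFieldType.
Variables (n k : nat) (c : F) (u : 'I_n -> F).
Hypothesis u_inj : injective u.

Let A (I : {set 'I_n}) : F :=
  \prod_(i in I) \prod_(j in ~: I) ((u i - u j - c) / (u i - u j)).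

(* The variables [v j] with [j] outside [S] are thought of as sent to infinity. *)
Let r (S : {set 'I_n}) (v : 'I_n -> F) i j : F :=
  if j \in S then (u i - v j + c) / (u i - v j) else 1.
Let h (S : {set 'I_n}) (v : 'I_n -> F) i j : F :=
  if (i \in S) && (j \in S) then (v i - v j + c) / (v i - v j) else 1.

(** Induction on a bound for the number of indices outside [S]. Such an index [z] is put back at a
    finite position [w]; the identity for [z |: S] holds for all but finitely many [w], and both
    sides have a limit. When [S] is everything, this is the square identity. *)
Lemma source_identity_at_infty (S : {set 'I_n}) (v : 'I_n -> F) :
    {in S &, injective v} ->
    (forall i j, j \in S -> u i != v j) ->
    (forall i j, j \in S -> u i - v j + c != 0) ->
  \sum_(I : {set 'I_n} | #|I| == k) (A I * \prod_(i in I) \prod_j r S v i j) =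
  \sum_(J : {set 'I_n} | #|J| == k)
    (\prod_(i in J) \prod_(j in ~: J) h S v i j * \prod_(j in J) \prod_i r S v i j).
Proof.
move: {2}(#|~: S|) (leqnn #|~: S|) => m.
elim: m S v => [|m IHm] S v.
  rewrite leqn0 cards_eq0 => /eqP S0; have -> : S = [set: 'I_n].
    by rewrite -[S]setCK S0 setC0.
  move=> v_inj uv uvc.
  transitivity (\sum_(I : {set 'I_n} | #|I| == k)
    (A I * \prod_(i in I) \prod_j ((u i - v j + c) / (u i - v j)))).
    apply: eq_bigr => I _; congr (_ * _); apply: eq_bigr => i _.
    by apply: eq_bigr => j _; rewrite /r inE.
  rewrite source_identity_square //; first last.
  - by move=> i j; apply: uvc; rewrite inE.
  - by move=> i j; apply: uv; rewrite inE.
  - by move=> i j; apply: v_inj; rewrite inE.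
  apply: eq_bigr => J _; congr (_ * _); apply: eq_bigr => i _;
    by apply: eq_bigr => j _; rewrite /h /r !inE.
move=> cardS v_inj uv uvc.
case: (set_0Vmem (~: S)) => [S0|[z]]; first by apply: IHm => //; rewrite S0 cards0.
rewrite inE => zS.
pose S' := z |: S; pose v' w := fun j => if j == z then w else v j.
have v'S w j : j \in S -> v' w j = v j.
  by rewrite /v'; case: eqP => // -> /(negP zS).
have rlim i j : tends_at_infty F (fun w => r S' (v' w) i j) (r S v i j).
  rewrite /r /S' /v' !inE; case: (eqVneq j z) => [->|jz] /=; last exact: tends_cst.
  rewrite (negPf zS); apply: tends_ext (tends_moebius _ (-1) (u i + c) (u i) _) => [w|].
    by congr (_ / _); ring.
  by rewrite oppr_eq0 oner_neq0.
(* The diagonal is excluded: at [i = j = z] the factor for [S'] is [c / 0 = 0], but the one for [S]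
   is 1. *)
have hlim i j : i != j -> tends_at_infty F (fun w => h S' (v' w) i j) (h S v i j).
  rewrite /h /S' /v' !inE; case: (eqVneq i z) => [->|iz] /=.
    rewrite (negPf zS) eq_sym => jz; rewrite (negPf jz) /=.
    case: (j \in S); last exact: tends_cst.
    apply: tends_ext (tends_moebius _ 1 (- v j + c) (- v j) _) => [w|].
      by congr (_ / _); ring.
    exact: oner_neq0.
  case: (eqVneq j z) => [->|jz] _ /=; last exact: tends_cst.
  rewrite (negPf zS) andbF andbT; case: (i \in S); last exact: tends_cst.
  apply: tends_ext (tends_moebius _ (-1) (v i + c) (v i) _) => [w|].
    by congr (_ / _); ring.
  by rewrite oppr_eq0 oner_neq0.
(* The three lists hold the values of [w] that could break, in turn, injectivity, [u i != w] and
   [u i - w + c != 0]. *)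
pose bad := [seq v j | j : 'I_n] ++ [seq u i | i : 'I_n] ++ [seq u i + c | i : 'I_n].
apply: (tends_unique F
  (fun w => \sum_(I : {set 'I_n} | #|I| == k)
     (A I * \prod_(i in I) \prod_j r S' (v' w) i j))
  (fun w => \sum_(J : {set 'I_n} | #|J| == k)
    (\prod_(i in J) \prod_(j in ~: J) h S' (v' w) i j *
     \prod_(j in J) \prod_i r S' (v' w) i j)) _ _ bad).
- apply: tends_sum => I _; apply: tendsM; first exact: tends_cst.
  by apply: tends_prod => i _; apply: tends_prod => j _.
- apply: tends_sum => J _; apply: tendsM.
    apply: tends_prod => i iJ; apply: tends_prod => j; rewrite inE => jJ.
    by apply: hlim; apply: contraNneq jJ => <-.
  by apply: tends_prod => i _; apply: tends_prod => j _.
move=> w; rewrite !mem_cat !negb_or => /and3P[wv wu wuc].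
apply: IHm.
- by move: cardS; rewrite (cardsD1 z) inE zS /S' setCU setIC -setDE.
- move=> i j; rewrite !inE => /orP[/eqP->|iS] /orP[/eqP->|jS] //.
  + rewrite (v'S w j) // /v' eqxx => wj; case/negP: wv.
    by rewrite wj map_f ?mem_enum.
  + rewrite (v'S w i) // /v' eqxx => wj; case/negP: wv.
    by rewrite -wj map_f ?mem_enum.
  by rewrite !v'S //; apply: v_inj.
- move=> i j; rewrite !inE => /orP[/eqP->|jS]; last by rewrite v'S // uv.
  rewrite /v' eqxx; apply: contraNneq wu => <-; by rewrite map_f ?mem_enum.
move=> i j; rewrite !inE => /orP[/eqP->|jS]; last by rewrite v'S // uvc.
rewrite /v' eqxx addrAC subr_eq0; apply: contraNneq wuc => <-.
exact: (map_f (fun i => u i + c)) (mem_enum _ _).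
Qed.
End Degenerate.

(** * Counting subsets by their trace on a fixed subset *)

(** [K] is determined by [K :\: S], any subset of the complement with [k - #|J|] elements. The test
    guards against truncated subtraction, which would give ['C(_, 0) = 1] when [J] is too large. *)
Lemma card_fixed_trace (T : finType) (S J : {set T}) (k : nat) : J \subset S ->
  #|[set K : {set T} | (#|K| == k) && (K :&: S == J)]| =
  if (#|J| <= k)%N then 'C(#|~: S|, k - #|J|) else 0%N.
Proof.
move=> JS; case: leqP => Jk; last first.
  apply/eqP; rewrite cards_eq0; apply/eqP/setP=> K; rewrite !inE.
  apply: contraTF Jk => /andP[/eqP <- /eqP <-].
  by rewrite -leqNgt subset_leq_card ?subsetIl.
have JA (A : {set T}) : A \subset ~: S -> (J :|: A) :&: S = J /\ (J :|: A) :\: S = A.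
  move=> AS; have /eqP AS0 : A :&: S == set0 by rewrite setI_eq0 disjoints_subset.
  have /eqP JS0 : J :\: S == set0 by rewrite setD_eq0.
  rewrite setIUl (setIidPl JS) AS0 setU0 setDUl JS0 set0U setDE.
  by rewrite (setIidPl AS).
rewrite -cards_draws -[RHS](card_in_imset (f := setU J)) => [|A A']; last first.
  rewrite !inE => /andP[/JA[_ AE] _] /andP[/JA[_ A'E] _] AA'.
  by rewrite -AE -A'E AA'.
apply: eq_card => K; rewrite inE; apply/andP/imsetP => [[/eqP cK /eqP KS]|[A]].
  exists (K :\: S); last by rewrite -KS setID.
  by rewrite inE -cK -(cardsID S K) KS addKn setDE subsetIr eqxx.
rewrite inE => /andP[/JA[JAS JAD] /eqP cA] ->.
by rewrite -(cardsID S (J :|: A)) JAS JAD cA subnKC // !eqxx.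
Qed.

(** Terms are grouped by their trace on the image of [h]; [j] counts the elements chosen outside
    that image. *)
Lemma sum_over_traces (R : comNzRingType) (T T' : finType) (k l : nat)
    (h : T' -> T) (G : {set T} -> R) :
  injective h -> #|T| = (#|T'| + l)%N ->
  \sum_(J : {set T} | #|J| == k) G (J :&: h @: [set: T']) =
  \sum_(0 <= j < (minn k l).+1)
     'C(l, j)%:R * \sum_(J : {set T'} | #|J| == (k - j)%N) G (h @: J).
Proof.
move=> h_inj cT; pose S := h @: [set: T'].
have cS : #|~: S| = l.
  by apply: (@addnI #|T'|); rewrite -cT -(cardsC S) card_imset // cardsT.
have sumS : \sum_(J : {set T} | #|J| == k) G (J :&: S) =
    \sum_(J in [set J : {set T} | J \subset S])
       G J *+ #|[set K : {set T} | (#|K| == k) && (K :&: S == J)]|.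
  rewrite (partition_big (fun J : {set T} => J :&: S)
             (mem [set J : {set T} | J \subset S])) => [|J _];
    last by rewrite /= inE subsetIr.
  apply: eq_big => J; rewrite ?inE //= -sumr_const => _.
  by apply: eq_big => [K|K /andP[_ /eqP->]]; rewrite ?inE.
have -> : \sum_(J : {set T} | #|J| == k) G (J :&: h @: [set: T']) =
    \sum_(J : {set T'}) G (h @: J) *+ (if (#|J| <= k)%N then 'C(l, k - #|J|) else 0%N).
  rewrite sumS; have -> : [set J : {set T} | J \subset S] =
      (fun J : {set T'} => h @: J) @: [set: {set T'}].
    apply/setP=> J; rewrite inE; apply/idP/imsetP => [JS|[K _ ->]]; last first.
      by rewrite imsetS // subsetT.
    exists (h @^-1: J); rewrite ?inE //; apply/setP => x.
    apply/idP/imsetP => [xJ|[y]]; last by rewrite inE => yJ ->.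
    by have /imsetP[y _ xE] := fintype.subsetP JS x xJ; exists y; rewrite ?inE -?xE.
  rewrite big_imset /=; last by move=> A A' _ _; apply: imset_inj.
  apply: eq_big => [J|J _]; first by rewrite inE.
  by rewrite card_fixed_trace ?cS ?card_imset // imsetS // subsetT.
under [RHS]eq_bigr do rewrite big_distrr big_mkcond /=.
rewrite exchange_big /=; apply: eq_bigr => J _.
rewrite -[LHS]mulr_natl.
case: leqP => Jk; last first.
  rewrite mul0r big1_seq // => j; rewrite mem_index_iota => _.
  by case: eqP => // Jkj; move: Jk; rewrite Jkj ltnNge leq_subr.
(* Beyond [l] the binomial vanishes and no [j] in the range fits [J]; otherwise, since [j <= k],
   only [j = k - #|J|] contributes. *)
have [kl|kl] := leqP (k - #|J|) l; last first.
  rewrite bin_small // mul0r big1_seq // => j; rewrite mem_index_iota ltnS.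
  rewrite leq_min => /and3P[_ _ /andP[jk jl]]; case: eqP => // Jkj.
  by move: kl; rewrite Jkj subKn // ltnNge jl.
rewrite (bigD1_seq (k - #|J|)%N) ?iota_uniq ?mem_index_iota ?ltnS ?leq_min ?leq_subr //=.
rewrite subKn // eqxx big1_seq ?addr0 // => j; rewrite mem_index_iota ltnS leq_min.
move=> /and3P[jJ _ /andP[jk _]]; case: eqP => // Jkj.
by move: jJ; rewrite Jkj subKn // eqxx.
Qed.

(** The [v j] occupy the first [m] of [n] places and the remaining [n - m] variables are at
    infinity. *)
Lemma source_identity (F : numFieldType) (n m k : nat) (c : F)
    (u : 'I_n -> F) (v : 'I_m -> F) :
    (m <= n)%N -> injective u -> injective v ->
    (forall i j, u i != v j) -> (forall i j, u i - v j + c != 0) ->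
  \sum_(I : {set 'I_n} | #|I| == k)
    (\prod_(i in I) \prod_(j in ~: I) ((u i - u j - c) / (u i - u j)) *
     \prod_(i in I) \prod_j ((u i - v j + c) / (u i - v j))) =
  \sum_(0 <= j < (minn k (n - m)).+1) 'C(n - m, j)%:R *
    \sum_(J : {set 'I_m} | #|J| == (k - j)%N)
      (\prod_(i in J) \prod_(j in ~: J) ((v i - v j + c) / (v i - v j)) *
       \prod_(i in J) \prod_j ((u j - v i + c) / (u j - v i))).
Proof.
move=> mn u_inj v_inj uv uvc.
pose h := widen_ord mn; pose S := h @: [set: 'I_m].
have h_inj : injective h by move=> i j /(congr1 val) /= /val_inj.
(* The default 0 fills the places outside [S], where the factors at infinity are 1. *)
pose v' (j : 'I_n) := odflt 0 (omap v (insub (val j))).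
have v'h j : v' (h j) = v j by rewrite /v' /= valK.
have prodS (f : 'I_n -> F) : \prod_j (if j \in S then f j else 1) = \prod_j f (h j).
  rewrite -big_mkcond big_imset /=; last by move=> i j _ _; apply: h_inj.
  by apply: eq_bigl => j; rewrite inE.
(* The summand of [J] depends only on its trace [K] on [S]: an index outside [S] contributes factors
   1, hence [S :\: K] instead of [~: K]. *)
pose G (K : {set 'I_n}) :=
  \prod_(i in K) \prod_(j in S :\: K) ((v' i - v' j + c) / (v' i - v' j)) *
  \prod_(i in K) \prod_j ((u j - v' i + c) / (u j - v' i)).
have := source_identity_at_infty F n k c u u_inj S v'.
set lhs := (X in _ -> _ -> _ -> X = _); set rhs := (X in _ -> _ -> _ -> _ = X).
have -> : lhs = \sum_(I : {set 'I_n} | #|I| == k)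
    (\prod_(i in I) \prod_(j in ~: I) ((u i - u j - c) / (u i - u j)) *
     \prod_(i in I) \prod_j ((u i - v j + c) / (u i - v j))).
  apply: eq_bigr => I _; congr (_ * _); apply: eq_bigr => i _.
  by rewrite prodS; apply: eq_bigr => j _; rewrite v'h.
have -> : rhs = \sum_(J : {set 'I_n} | #|J| == k) G (J :&: S).
  apply: eq_bigr => J _; congr (_ * _).
    rewrite big_mkcond [RHS]big_mkcond; apply: eq_bigr => i _ /=; rewrite !inE.
    case: (i \in J) => //=; case: (i \in S) => /=; last by rewrite big1.
    rewrite big_mkcond [RHS]big_mkcond; apply: eq_bigr => j _ /=; rewrite !inE.
    by case: (j \in J); case: (j \in S).
  rewrite big_mkcond [RHS]big_mkcond; apply: eq_bigr => i _ /=; rewrite !inE.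
  by case: (i \in J) => //=; case: (i \in S) => //=; rewrite big1.
move=> ->; first last.
- by move=> i j /imsetP[j' _ ->]; rewrite v'h.
- by move=> i j /imsetP[j' _ ->]; rewrite v'h.
- by move=> i j /imsetP[i' _ ->] /imsetP[j' _ ->]; rewrite !v'h => /v_inj ->.
rewrite (sum_over_traces _ _ _ k (n - m) h) //; last by rewrite !card_ord subnKC.
apply: eq_bigr => j _; congr (_ * _); apply: eq_bigr => J _.
rewrite /G; have -> : S :\: h @: J = h @: (~: J).
  apply/setP=> i; rewrite inE; apply/andP/imsetP => [[iJ /imsetP[i' _ iE]]|[i' i'J ->]].
    by exists i' => //; rewrite inE; apply: contra iJ => ?; rewrite iE imset_f.
  by rewrite (mem_imset _ _ h_inj) -in_setC i'J imset_f ?inE.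
rewrite !big_imset /=; try by move=> ? ? _ _; apply: h_inj.
congr (_ * _); apply: eq_bigr => i _; last by apply: eq_bigr => j' _; rewrite v'h.
rewrite big_imset /=; last by move=> ? ? _ _; apply: h_inj.
by apply: eq_bigr => j' _; rewrite !v'h.
Qed.

(** * The functional equation of Gamma *)

Section GammaShift.
Local Open Scope complex_scope.
Local Open Scope classical_set_scope.

(* If [f] diverges then so does [g], and both limits are the junk value [0]. *)
Lemma lim_recurrence (K : numFieldType) (z : K) (r f g : nat -> K^o) :
    z != 0 -> (forall n, r n != 0) -> r @ \oo --> (1 : K^o) ->
    (forall n, g n.+1 = z * r n * f n.+1) ->
  limn g = z * limn f.
Proof.
move=> z0 r0 r1 gE.
have cr : (fun n => z * r n : K^o) @ \oo --> (z : K^o).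
  by rewrite -[X in _ --> X]mulr1; apply: cvgM => //; exact: cvg_cst.
have toS (l : K^o) : f @ \oo --> l -> g @ \oo --> (z * l : K^o).
  rewrite -(cvg_shiftS f) -(cvg_shiftS g) => fl.
  have -> : [sequence g n.+1]_n = (fun n => (z * r n) * f n.+1) by exact/funext.
  exact: cvgM.
have ofS (l : K^o) : g @ \oo --> l -> f @ \oo --> (z^-1 * l : K^o).
  rewrite -(cvg_shiftS f) -(cvg_shiftS g) => gl.
  have -> : [sequence f n.+1]_n = (fun n => (z * r n)^-1 * g n.+1).
    by apply/funext => n; rewrite /= gE mulrA mulVf ?mul1r ?mulf_neq0.
  by apply: cvgM => //; apply: cvgV.
have [[l fl]|dv] := pselect (exists l : K^o, f @ \oo --> l).
  by rewrite (cvg_lim _ fl) //; apply/cvg_lim => //; exact: toS.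
have -> : limn f = 0 by apply: dvgP => fl; apply: dv; exists (limn f).
rewrite mulr0; apply: dvgP => gl; apply: dv.
by exists (z^-1 * limn g); apply: ofS.
Qed.

Variable R : realType.
Local Notation C := R[i].

Let gauss (z : C) (n : nat) : C^o :=
  (n`!)%:R * natcpow n z / \prod_(j < n.+1) (z + j%:R).

Lemma natcpowD1 n (z : C) : natcpow n.+1 (z + 1) = n.+1%:R * natcpow n.+1 z.
Proof.
rewrite /natcpow; case: z => x y /=.
rewrite addr0 mulrDl mul1r expRD lnK ?posrE ?ltr0n //.
rewrite mulrA; congr (_ * _).
rewrite rmorphM mulrC; congr (_ * _).
by rewrite rmorph_nat.
Qed.

(** Passing from [z] to [z + 1] drops the factor [z] from the denominator and adds [z + n.+2]. The
    index is a successor so that [ln] is taken at a positive number. *)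
Lemma gaussD1 n (z : C) : (forall m : nat, z + m%:R != 0) ->
  gauss (z + 1) n.+1 = z * (n.+1%:R / (z + n.+2%:R)) * gauss z n.+1.
Proof.
move=> z0; rewrite /gauss natcpowD1.
rewrite [in RHS]big_ord_recl [in LHS]big_ord_recr /= addr0.
have -> : \prod_(i < n.+1) (z + (bump 0 i)%:R) = \prod_(i < n.+1) (z + 1 + i%:R).
  by apply: eq_bigr => i _; rewrite /bump /= add1n -addrA -natr1 [_ + 1]addrC.
have P0 : \prod_(i < n.+1) (z + 1 + i%:R) != 0.
  by apply/prodf_neq0 => i _; rewrite -addrA [1 + _]addrC natr1.
have := z0 0%N; rewrite addr0 => z00.
have := z0 n.+2; have -> : z + n.+2%:R = z + 1 + n.+1%:R by rewrite -natr1; ring.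
move=> z2.
by field; rewrite nat1r P0 z00 z2.
Qed.


Lemma cvg_harmonic_complex : (fun n : nat => (n.+1%:R^-1 : C^o)) @ \oo --> (0 : C^o).
Proof.
(* A positive complex number has zero imaginary part, which reduces the claim to the real harmonic
   sequence. *)
apply/cvgrPdist_lt => -[e y]; rewrite ltcE /= => /andP[/eqP -> e0].
have /cvgrPdist_lt/(_ e e0) := @cvg_harmonic R.
apply: filterS => n /=; rewrite !sub0r !normrN /harmonic.
rewrite !ger0_norm ?invr_ge0 ?ler0n // => ne.
have -> : n.+1%:R^-1 = (n.+1%:R^-1)%:C :> C by rewrite fmorphV rmorph_nat.
by rewrite ltcR.
Qed.

Lemma cvg_gauss_ratio (z : C) : (forall m : nat, z + m%:R != 0) ->
  (fun n : nat => (n.+1%:R / (z + n.+2%:R) : C^o)) @ \oo --> (1 : C^o).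
Proof.
move=> z0.
have -> : (fun n : nat => (n.+1%:R / (z + n.+2%:R) : C^o)) =
          (fun n => (1 + (z + 1) * n.+1%:R^-1)^-1).
  apply/funext => n; have n0 : n.+1%:R != 0 :> C by rewrite pnatr_eq0.
  have -> : 1 + (z + 1) * n.+1%:R^-1 = (z + n.+2%:R) / n.+1%:R.
    by rewrite -[n.+2%:R]natr1; field; rewrite nat1r.
  by rewrite invf_div.
rewrite -[X in _ --> X]invr1; apply: cvgV; first exact: oner_neq0.
rewrite -[X in _ --> X]addr0; apply: cvgD; first exact: cvg_cst.
rewrite -(mulr0 (z + 1)); apply: cvgM; first exact: cvg_cst.
exact: cvg_harmonic_complex.
Qed.

Lemma GammaD1 (z : C) : (forall m : nat, z + m%:R != 0) ->
  Gamma (z + 1) = z * Gamma z.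
Proof.
move=> z0; have z00 : z != 0 by have := z0 0%N; rewrite addr0.
apply: (@lim_recurrence _ z (fun n => n.+1%:R / (z + n.+2%:R)) (gauss z) (gauss (z + 1))).
- exact: z00.
- by move=> n; rewrite mulf_neq0 ?invr_eq0 ?pnatr_eq0.
- exact: cvg_gauss_ratio.
- by move=> n; apply: gaussD1.
Qed.
End GammaShift.

(** * Algebra of the rescaled Gamma arguments *)

Section Rescaling.
Variables (F : numFieldType) (j h y x : F).
Hypotheses (jj : j * j = -1) (h_neq0 : h != 0).

(** Here [j], [h] and [y] stand for ['i], [hbar * mu] and [g / (2 * hbar)], so that [h * 2 * y] is
    [mu * g]. *)
Lemma scaled_offset (tau : bool) :
  j / h * (x + ((if tau then 0 else j * h) -
                (if tau then 1 else -1) * j * (h * 2 * y) / 2)) =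
  if tau then j * x / h + y else j * x / h - y - 1.
Proof.
case: tau.
  transitivity (j * x / h - (j * j) * y); first by field; rewrite h_neq0.
  by rewrite jj; ring.
transitivity (j * x / h + (j * j) * (1 + y)); first by field; rewrite h_neq0.
by rewrite jj; ring.
Qed.

Lemma scaled_offset_coupling (tau : bool) :
  j / h * (x + ((if tau then 0 else j * h) -
                (if tau then 1 else -1) * j * (h * 2 * y) / 2) +
           (if tau then 1 else -1) * j * (h * 2 * y)) =
  if tau then j * x / h - y else j * x / h + y - 1.
Proof.
rewrite mulrDr scaled_offset; case: tau.
  transitivity (j * x / h + y + (j * j) * 2 * y); first by field; rewrite h_neq0.
  by rewrite jj; ring.
transitivity (j * x / h - y - 1 - (j * j) * 2 * y); first by field; rewrite h_neq0.
by rewrite jj; ring.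
Qed.

Lemma scaled_step (s : F) : j * (x - s * j * h) / h = j * x / h + s.
Proof.
transitivity (j * x / h - (j * j) * s); first by field; rewrite h_neq0.
by rewrite jj; ring.
Qed.
End Rescaling.

(** * Action of the shift operators on the kernel *)

Section Kernel.
Local Open Scope complex_scope.
Variables (R : realType) (hbar mu g : R).
Hypotheses (hbar_gt0 : 0 < hbar) (mu_gt0 : 0 < mu).
Let H : R[i] := (hbar * mu)%:C.
Let gam : R[i] := (g / (2 * hbar))%:C.

Definition kernel (x : R[i]) : R[i] :=
  Gamma ('i * x / (hbar * mu)%:C - (g / (2 * hbar))%:C) /
  Gamma ('i * x / (hbar * mu)%:C + (g / (2 * hbar))%:C).

Definition step (tau : bool) : R[i] := sgnC R tau * 'i * (hbar * mu)%:C.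

Definition coupling (tau : bool) : R[i] := sgnC R tau * 'i * (mu * g)%:C.

(* Chosen so that the shift [x -> x - step tau] multiplies [kernel x] by
   [(w + coupling tau) / w] with [w = x + offset tau]. *)
Definition offset (tau : bool) : R[i] :=
  (if tau then 0 else 'i * (hbar * mu)%:C) - coupling tau / 2.

Let H_neq0 : H != 0.
Proof. by rewrite /H (fmorph_eq0 (real_complex R)) gt_eqF // mulr_gt0. Qed.

Let couplingE tau : coupling tau = sgnC R tau * 'i * (H * 2 * gam).
Proof.
rewrite /coupling /H /gam -(rmorph_nat (real_complex R) 2) -!rmorphM /=.
by congr (_ * _%:C); field; rewrite gt_eqF.
Qed.

Let ii : 'i * 'i = -1 :> R[i]. Proof. by rewrite -expr2 sqrCi. Qed.

Section Step.
Variable x : R[i].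
Hypothesis a_nint : forall z : int, 'i * x / H - gam != z%:~R.
Hypothesis b_nint : forall z : int, 'i * x / H + gam != z%:~R.

Let nonpole (z : R[i]) : (forall k : int, z != k%:~R) -> forall m : nat, z + m%:R != 0.
Proof. by move=> zn m; rewrite addr_eq0; have := zn (- m%:Z); rewrite rmorphN. Qed.

Let pred_nint (z : R[i]) : (forall k : int, z != k%:~R) -> forall k : int, z - 1 != k%:~R.
Proof. by move=> zn k; rewrite subr_eq; have := zn (k + 1); rewrite rmorphD. Qed.

Let weightE tau : ('i / H) * (x + offset tau) =
  if tau then 'i * x / H + gam else 'i * x / H - gam - 1.
Proof. by rewrite /offset couplingE; apply: scaled_offset. Qed.

Let weightcE tau : ('i / H) * (x + offset tau + coupling tau) =
  if tau then 'i * x / H - gam else 'i * x / H + gam - 1.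
Proof. by rewrite /offset couplingE; apply: scaled_offset_coupling. Qed.

Lemma offset_neq0 tau : x + offset tau != 0.
Proof.
have : ('i / H) * (x + offset tau) != 0.
  rewrite weightE; case: tau; first exact: (b_nint 0).
  exact: (pred_nint _ a_nint 0).
by rewrite mulf_eq0 negb_or => /andP[].
Qed.

Lemma offsetc_neq0 tau : x + offset tau + coupling tau != 0.
Proof.
have : ('i / H) * (x + offset tau + coupling tau) != 0.
  rewrite weightcE; case: tau; first exact: (a_nint 0).
  exact: (pred_nint _ b_nint 0).
by rewrite mulf_eq0 negb_or => /andP[].
Qed.

(** Let [a] and [b] be the Gamma arguments in the numerator and denominator. The shift raises or
    lowers both by 1, giving the factor [a / b] or [(b - 1) / (a - 1)]; scaling by ['i / H]
    identifies it with the stated ratio. *)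
Lemma kernel_step tau : kernel (x - step tau) =
  kernel x * ((x + offset tau + coupling tau) / (x + offset tau)).
Proof.
have iH : 'i / H != 0 by rewrite mulf_neq0 ?neq0Ci ?invr_eq0.
have -> : (x + offset tau + coupling tau) / (x + offset tau) =
    (('i / H) * (x + offset tau + coupling tau)) / (('i / H) * (x + offset tau)).
  by rewrite -mulf_div divff // mul1r.
rewrite weightE weightcE.
have shiftE : 'i * (x - step tau) / H = 'i * x / H + sgnC R tau.
  exact: scaled_step.
rewrite /kernel -/H -/gam shiftE; case: tau {shiftE} => /=.
  rewrite addrAC GammaD1; last exact: nonpole.
  rewrite [_ + 1 + gam]addrAC GammaD1; last exact: nonpole.
  move: (Gamma _) (Gamma _) => ga gb.
  by rewrite invfM; ring.
(* For the negative sign, the functional equation is used backwards, at [a - 1] and [b - 1]. *)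
rewrite addrAC [_ + -1 + gam]addrAC.
have := GammaD1 R _ (nonpole _ (pred_nint _ a_nint)); rewrite subrK => ->.
have := GammaD1 R _ (nonpole _ (pred_nint _ b_nint)); rewrite subrK => ->.
have := pred_nint _ a_nint 0; have := pred_nint _ b_nint 0.
move: ('i * x / H - gam - 1) ('i * x / H + gam - 1) => a b b0 a0.
move: (Gamma a) (Gamma b) => ga gb.
transitivity (ga / gb * (a / a) * (b / b)); last by rewrite invfM; ring.
by rewrite !divff // !mulr1.
Qed.
End Step.

(** The array [x] is kept abstract so that the rows can be indexed by [p] or by [q]. *)
Lemma prod_kernel_shift (T T' : finType) tau (I : {set T}) (x : T -> T' -> R[i]) :
    (forall m n (z : int), 'i * x m n / H - gam != z%:~R /\ 'i * x m n / H + gam != z%:~R) ->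
  \prod_m \prod_n kernel (if m \in I then x m n - step tau else x m n) =
  \prod_m \prod_n kernel (x m n) *
  \prod_(m in I) \prod_n ((x m n + offset tau + coupling tau) / (x m n + offset tau)).
Proof.
move=> x_gen; rewrite [X in _ * X]big_mkcond -big_split; apply: eq_bigr => m _ /=.
case: ifP => _; last by rewrite mulr1.
rewrite -big_split; apply: eq_bigr => n _ /=; apply: kernel_step => z.
  by have [] := x_gen m n z.
by have [] := x_gen m n z.
Qed.

Section Operators.
Variables (N M : nat) (p : 'I_N -> R[i]) (q : 'I_M -> R[i]).
Hypothesis pq_gen : generic_pq hbar mu g p q.
Let pq_nint : forall m n (z : int),
  'i * (p m - q n) / H - gam != z%:~R /\ 'i * (p m - q n) / H + gam != z%:~R.
Proof. by case: pq_gen => _ []. Qed.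

Lemma Anr_Khat_left tau k :
  Anr hbar mu g tau k (fun p' => Khat hbar mu g p' q) p =
  Khat hbar mu g p q *
  \sum_(I : {set 'I_N} | #|I| == k)
    (\prod_(i in I) \prod_(j in ~: I) ((p i - p j - coupling tau) / (p i - p j)) *
     \prod_(i in I) \prod_j
       ((p i - q j + offset tau + coupling tau) / (p i - q j + offset tau))).
Proof.
rewrite big_distrr; apply: eq_bigr => I _ /=; rewrite mulrCA; congr (_ * _).
rewrite -(prod_kernel_shift _ _ tau I (fun m n => p m - q n) pq_nint).
apply: eq_bigr => m _; apply: eq_bigr => n _ /=; rewrite /kernel.
by case: ifP => _ //; rewrite /step [p m - _ - q n]addrAC.
Qed.

(** The opposite sign moves [q n] by [+ step tau], hence [p m - q n] by [- step tau], exactly as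
    when [p m] is shifted. *)
Lemma Anr_Khat_right tau k :
  Anr hbar mu g (~~ tau) k (fun q' => Khat hbar mu g p q') q =
  Khat hbar mu g p q *
  \sum_(J : {set 'I_M} | #|J| == k)
    (\prod_(i in J) \prod_(j in ~: J) ((q i - q j + coupling tau) / (q i - q j)) *
     \prod_(i in J) \prod_j
       ((p j - q i + offset tau + coupling tau) / (p j - q i + offset tau))).
Proof.
have sgnN : sgnC R (~~ tau) = - sgnC R tau by case: tau; rewrite /= ?opprK.
rewrite big_distrr; apply: eq_bigr => J _ /=; rewrite mulrCA sgnN; congr (_ * _).
  by apply: eq_bigr => i _; apply: eq_bigr => j _; rewrite !mulNr opprK.
have qp_nint n m (z : int) : 'i * (p m - q n) / H - gam != z%:~R /\
    'i * (p m - q n) / H + gam != z%:~R := pq_nint m n z.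
transitivity (\prod_n \prod_m kernel (p m - q n) *
  \prod_(i in J) \prod_j
       ((p j - q i + offset tau + coupling tau) / (p j - q i + offset tau))).
  rewrite -(prod_kernel_shift _ _ tau J (fun n m => p m - q n) qp_nint) /Khat exchange_big.
  apply: eq_bigr => n _; apply: eq_bigr => m _ /=; rewrite /kernel.
  by case: ifP => _ //; rewrite /step !mulNr opprK opprD addrA.
by congr (_ * _); rewrite exchange_big.
Qed.
End Operators.
End Kernel.

Theorem theorem4p6 (R : realType) (hbar mu g : R)
  (hhbar : 0 < hbar) (hmu : 0 < mu) (hg : 0 < g)
  (N l k : nat) (hl : (l <= N)%N) (hk1 : (1 <= k)%N) (hkN : (k <= N)%N)
  (tau : bool) (p : 'I_N -> R[i]) (q : 'I_(N - l) -> R[i]) :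
  generic_pq hbar mu g p q ->
  Anr hbar mu g tau k (fun p' => Khat hbar mu g p' q) p =
  \sum_(0 <= j < (minn k l).+1)
     'C(l, j)%:R * Anr hbar mu g (~~ tau) (k - j) (fun q' => Khat hbar mu g p q') q.
Proof.
move=> pq_gen; have [p_dist [q_dist pq_nint]] := pq_gen.
pose c := coupling R mu g tau; pose d := offset R hbar mu g tau.
(* Translating by the offset turns the denominators into [u i - q j] and preserves the differences
   of the [p i]. *)
pose u i := p i + d.
have u_inj : injective u.
  move=> i j /addIr pij; apply/eqP; apply: contraT => /p_dist.
  by rewrite pij eqxx.
have q_inj : injective q.
  by move=> i j qij; apply/eqP; apply: contraT => /q_dist; rewrite qij eqxx.
have uqE i j : u i - q j = p i - q j + d by rewrite /u addrAC.
have ratioE i j : u i - u j = p i - p j by rewrite /u opprD addrACA subrr addr0.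
have uq i j : u i != q j.
  rewrite -subr_eq0 uqE; apply: offset_neq0 => // z.
    by have [] := pq_nint i j z.
  by have [] := pq_nint i j z.
have uqc i j : u i - q j + c != 0.
  rewrite uqE; apply: offsetc_neq0 => // z.
    by have [] := pq_nint i j z.
  by have [] := pq_nint i j z.
have := source_identity _ N (N - l) k c u q (leq_subr _ _) u_inj q_inj uq uqc.
rewrite subKn // Anr_Khat_left // => id_uq.
transitivity (Khat hbar mu g p q * \sum_(I : {set 'I_N} | #|I| == k)
    (\prod_(i in I) \prod_(j in ~: I) ((u i - u j - c) / (u i - u j)) *
     \prod_(i in I) \prod_j ((u i - q j + c) / (u i - q j)))).
  congr (_ * _); apply: eq_bigr => I _; congr (_ * _); apply: eq_bigr => i _;
    by apply: eq_bigr => j _; rewrite ?ratioE ?uqE.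
rewrite id_uq big_distrr; apply: eq_bigr => j _; rewrite Anr_Khat_right //= mulrCA.
congr (_ * (_ * _)); apply: eq_bigr => J _; congr (_ * _); apply: eq_bigr => i _.
by apply: eq_bigr => i' _; rewrite uqE.
Qed.
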